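(* Let $n\ge2$ and $k\in\mathbb{Z}\setminus\{0\}$. Both posets $([1,\lambda^k],\preceq)$ and $([1,\lambda^k],\preceq_r)$ are lattices.
   Context: Let $x$ be a transcendental parameter. $G(\infty,\infty,n)$ is the group of $n\times n$ monomial matrices (exactly one nonzero entry in each row and column) all of whose nonzero entries are of the form $x^m$, $m\in\mathbb{Z}$, with product of all nonzero entries equal to $1$. Generating set: $X=\{t_i\ (i\in\mathbb{Z}),\, s_3,\dots,s_n\}$, where $t_i$ is the block diagonal matrix with upper left $2\times2$ block $\begin{pmatrix}0 & x^{-i} \\ x^i & 0\end{pmatrix}$ and lower right block $I_{n-2}$, and $s_j$ ($3\le j\le n$) is the permutation matrix of the transposition $(j-1,j)$. All elements of $X$ are involutions and $X$ generates the group. For $w\in G(\infty,\infty,n)$, $\ell(w)$ is the minimal length of a word in elements of $X$ representing $w$. Partial orders: $v\preceq w$ if $\ell(v)+\ell(v^{-1}w)=\ell(w)$, and $v\preceq_r w$ if $\ell(wv^{-1})+\ell(v)=\ell(w)$. $[1,w]=\{v : v\preceq w\}$. $\lambda$ denotes the diagonal matrix $\mathrm{diag}(x^{-(n-1)},x,\dots,x)\in G(\infty,\infty,n)$. The element $\lambda^k$ is balanced, i.e. $[1,\lambda^k]=\{v : v\preceq_r\lambda^k\}$. *)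

(* Defs.v *)
From mathcomp Require Import all_boot all_order all_algebra.
From mathcomp Require Import boolp classical_sets.

Set Implicit Arguments.
Unset Strict Implicit.
Unset Printing Implicit Defensive.

Import Order.TTheory GRing.Theory Num.Theory.
Local Open Scope ring_scope.
Local Open Scope classical_set_scope.

Definition is_poset_on (T : Type) (S : set T) (le : T -> T -> Prop) : Prop :=
  [/\ forall a, S a -> le a a,
      forall a b, S a -> S b -> le a b -> le b a -> a = b
    & forall a b c, S a -> S b -> S c -> le a b -> le b c -> le a c].

Definition is_meet_in (T : Type) (S : set T) (le : T -> T -> Prop)
    (a b m : T) : Prop :=
  [/\ S m, le m a, le m b & forall c, S c -> le c a -> le c b -> le c m].

Definition is_join_in (T : Type) (S : set T) (le : T -> T -> Prop)
    (a b j : T) : Prop :=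
  [/\ S j, le a j, le b j & forall c, S c -> le a c -> le b c -> le j c].

Definition is_lattice_on (T : Type) (S : set T) (le : T -> T -> Prop) : Prop :=
  is_poset_on S le /\
  forall a b, S a -> S b ->
    (exists m, is_meet_in S le a b m) /\ (exists j, is_join_in S le a b j).

(* Integer powers of a matrix: for an arbitrary size n the type 'M[F]_n is not
   a unitRingType, so the generic exprz does not apply. *)
Definition expmxz (F : fieldType) (n : nat) (A : 'M[F]_n) (k : int) : 'M[F]_n :=
  match k with
  | Posz m => A ^+ m
  | Negz m => invmx (A ^+ m.+1)
  end.

Definition monomial_mx (F : fieldType) (n : nat) (A : 'M[F]_n) : Prop :=
  (forall i, exists! j, A i j != 0) /\ (forall j, exists! i, A i j != 0).

Definition G_oo_oo (F : fieldType) (x : F) (n : nat) : set 'M[F]_n :=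
  [set A | [/\ monomial_mx A,
               forall i j, A i j != 0 -> exists m : int, A i j = x ^ m
             & \prod_i \prod_(j | A i j != 0) A i j = 1]].

(* Rows and columns are numbered from 0, one less than the usual numbering. *)
Definition tgen (F : fieldType) (x : F) (n : nat) (m : int) : 'M[F]_n :=
  \matrix_(i < n, j < n)
    if (i == 0%N :> nat) && (j == 1%N :> nat) then x ^ (- m)
    else if (i == 1%N :> nat) && (j == 0%N :> nat) then x ^ m
    else ((1 < i)%N && (i == j))%:R.

(* With the numbering from 0, s_j (3 <= j <= n) exchanges a = j-2 and b = j-1. *)
Definition Xgen (F : fieldType) (x : F) (n : nat) : set 'M[F]_n :=
  [set A | (exists m : int, A = tgen x n m) \/
           (exists a b : 'I_n, [/\ (0 < a)%N, b = a.+1 :> nat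
                                 & A = tperm_mx a b])].

Definition has_word (F : fieldType) (x : F) (n : nat) (w : 'M[F]_n) (l : nat)
    : Prop :=
  exists s : seq 'M[F]_n,
    [/\ size s = l, forall A, A \in s -> Xgen x A & \prod_(A <- s) A = w].

(* The generators are involutions, so words need no formal inverses; the value
   0 on matrices that no word represents is a dummy one. *)
Definition ell (F : fieldType) (x : F) (n : nat) (w : 'M[F]_n) : nat :=
  match pselect (exists l, `[< has_word x w l >]) with
  | left ex => ex_minn ex
  | right _ => 0%N
  end.

Definition prec (F : fieldType) (x : F) (n : nat) (v w : 'M[F]_n) : Prop :=
  (ell x v + ell x (invmx v *m w) = ell x w)%N.

Definition precr (F : fieldType) (x : F) (n : nat) (v w : 'M[F]_n) : Prop :=
  (ell x (w *m invmx v) + ell x v = ell x w)%N.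

Definition interval1 (F : fieldType) (x : F) (n : nat) (w : 'M[F]_n)
    : set 'M[F]_n :=
  [set v | G_oo_oo x v /\ prec x v w].

Definition lambda (F : fieldType) (x : F) (n : nat) : 'M[F]_n :=
  diag_mx (\row_(j < n) if j == 0%N :> nat then x ^ (- (n.-1)%:Z) else x).

(* Main.v *)
From HB Require Import structures.
Require Import Defs.
From mathcomp Require Import all_boot all_order all_algebra all_fingroup.
From mathcomp Require Import boolp classical_sets.
From mathcomp Require Import zify ring.

Set Implicit Arguments.
Unset Strict Implicit.
Unset Printing Implicit Defensive.

Import Order.TTheory GRing.Theory Num.Theory.
Local Open Scope ring_scope.

(** The idea is that word length in G(oo,oo,n) is a sum over pairs of rows.

An element is a permutation (the column of the nonzero entry of each row) with
an integer exponent on every row.  For rows j < i, let the state of the pair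
consist of a flag, telling whether the entry of row i lies to the left of the
entry of row j, and a label, the exponent of whichever of the two rows has its
entry further to the right.  View the states as the vertices of the complete
bipartite graph whose two sides are the two values of the flag: distinct states
are at distance 1 if their flags differ and at distance 2 otherwise.  Let the
distance of two elements be the sum over all pairs of the distances of their
states.  Left multiplication by u permutes the pairs of rows and, on each of
them, flips flags and shifts labels of the same flag by a common amount, so
this distance is left invariant ([mono_distM]).  A generator differs from 1 in
the state of a single pair, by a single step ([reflection_state]), and every
element other than 1 is shortened by some generator ([atom_descent]).  Hence the
word length of v is its distance to 1 ([ell_mono_mx]).

It follows that v is a prefix of w if and only if, on every pair of rows, the
state of v lies on a geodesic from the state of 1 to the state of w
([lprefix_pairs]).  Three local criteria come out of this:
- v is a prefix of lambda^k iff every row whose entry lies to the right of the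
  entry of some earlier row has exponent 0 or k ([lprefix_lambda]);
- this condition for v and k is the same as for v^-1 and -k, so lambda^k is
  balanced ([lambda_balanced]);
- whether a generator is a prefix of z depends on two adjacent rows of z
  ([reflection_lprefix]).

With the last criterion, any two generators have a join in the interval: st if
they commute, sts if they are braided, and diag(x^-k, x^k, 1, ..., 1) for two
distinct t_p and t_q ([atom_join]).  In a balanced interval, joins of generators
propagate to joins of arbitrary elements by induction from the top, and since
lengths are bounded, meets come for free as maximal common lower bounds
([balanced_interval_lattice]).  Finally v |-> v^-1 lambda^k is an isomorphism
from the opposite of the prefix order onto the suffix order, which settles the
second poset ([balanced_interval_lattice_r]). *)

(** * Transport of lattices *)

Lemma is_lattice_on_opp (T : Type) (S : set T) (le : T -> T -> Prop) :
  is_lattice_on S le -> is_lattice_on S (fun a b => le b a).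
Proof.
move=> [[le_refl le_anti le_trans] latS]; split; first split=> //.
- by move=> a b Sa Sb leba leab; apply: le_anti.
- by move=> a b c Sa Sb Sc leba lecb; apply: (le_trans c b a).
move=> a b Sa Sb; have [[m [? ? ? ?]] [j [? ? ? ?]]] := latS a b Sa Sb.
by split; [exists j | exists m].
Qed.

Lemma is_lattice_on_image (T U : Type) (S : set T) (le : T -> T -> Prop)
    (S' : set U) (le' : U -> U -> Prop) (f : T -> U) :
    (forall y, S' y <-> exists2 x, S x & f x = y) ->
    (forall x y, S x -> S y -> le' (f x) (f y) <-> le x y) ->
  is_lattice_on S le -> is_lattice_on S' le'.
Proof.
move=> imS lef [[le_refl le_anti le_trans] latS]; split; first split.
- by move=> _ /imS[x Sx <-]; apply/lef=> //; apply: le_refl.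
- move=> _ _ /imS[x Sx <-] /imS[y Sy <-] /lef lexy /lef leyx.
  by congr f; apply: le_anti; [| | apply: lexy | apply: leyx].
- move=> _ _ _ /imS[x Sx <-] /imS[y Sy <-] /imS[z Sz <-].
  move=> /(lef _ _ Sx Sy) lexy /(lef _ _ Sy Sz) leyz.
  by apply/lef=> //; apply: le_trans lexy leyz.
have S'f x : S x -> S' (f x) by move=> Sx; apply/imS; exists x.
move=> _ _ /imS[x Sx <-] /imS[y Sy <-].
have [[m [Sm mx my m_max]] [j [Sj xj yj j_min]]] := latS x y Sx Sy; split.
  exists (f m); split; [exact: S'f | exact/lef | exact/lef |].
  move=> _ /imS[z Sz <-] /(lef _ _ Sz Sx) zx /(lef _ _ Sz Sy) zy.
  by apply/lef=> //; apply: m_max.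
exists (f j); split; [exact: S'f | exact/lef | exact/lef |].
move=> _ /imS[z Sz <-] /(lef _ _ Sx Sz) xz /(lef _ _ Sy Sz) yz.
by apply/lef=> //; apply: j_min.
Qed.

(** * Intervals below a balanced element of a group *)

Section BalancedInterval.
Local Open Scope group_scope.

Variables (gT : groupType) (L : gT -> nat).

Definition lprefix (v w : gT) := (L v + L (v^-1 * w) = L w)%N.
Definition rprefix (v w : gT) := (L (w * v^-1) + L v = L w)%N.

Hypothesis L1 : L 1 = 0%N.
Hypothesis L_eq0 : forall v, L v = 0%N -> v = 1.
Hypothesis L_mul : forall v w : gT, (L (v * w) <= L v + L w)%N.

Lemma divg_path (u v w : gT) : (u^-1 * v)^-1 * (u^-1 * w) = v^-1 * w.
Proof. by rewrite invgM invgK -mulgA mulVKg. Qed.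

Lemma length_path (u v w : gT) :
  (L (u^-1 * w) <= L (u^-1 * v) + L (v^-1 * w))%N.
Proof. by have := L_mul (u^-1 * v) (v^-1 * w); rewrite -mulgA mulVKg. Qed.

Lemma length_path1 (v w : gT) : (L w <= L v + L (v^-1 * w))%N.
Proof. by have := length_path 1 v w; rewrite invg1 !mul1g. Qed.

Lemma lprefix1 w : lprefix 1 w.
Proof. by rewrite /lprefix L1 invg1 mul1g. Qed.

Lemma lprefix_refl w : lprefix w w.
Proof. by rewrite /lprefix mulVg L1 addn0. Qed.

Lemma lprefix_leq v w : lprefix v w -> (L v <= L w)%N.
Proof. by move=> <-; rewrite leq_addr. Qed.

Lemma lprefix_leq_eq v w : lprefix v w -> (L w <= L v)%N -> v = w.
Proof.
rewrite /lprefix => vw le_wv.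
have /L_eq0/eqP : L (v^-1 * w) = 0%N by lia.
by rewrite mulg_eq1 eqg_inv => /eqP.
Qed.

Lemma lprefix_anti v w : lprefix v w -> lprefix w v -> v = w.
Proof. by move=> vw /lprefix_leq; apply: lprefix_leq_eq. Qed.

Lemma lprefix_trans v u w : lprefix u v -> lprefix v w -> lprefix u w.
Proof.
rewrite /lprefix => uv vw.
by have := length_path u v w; have := length_path1 u w; lia.
Qed.

Lemma lprefix_shift u v w : lprefix u v -> lprefix u w ->
  lprefix (u^-1 * v) (u^-1 * w) <-> lprefix v w.
Proof. by rewrite /lprefix divg_path => uv uw; split; lia. Qed.

Lemma lprefix_mul (u m w : gT) : lprefix u w -> lprefix m (u^-1 * w) ->
  lprefix u (u * m) /\ lprefix (u * m) w.
Proof.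
have quot : (u * m)^-1 * w = m^-1 * (u^-1 * w) by rewrite invgM mulgA.
rewrite /lprefix mulKg quot => uw muw.
have := length_path1 (u * m) w; rewrite quot.
by have := L_mul u m; lia.
Qed.

Variable D : gT.
Hypothesis balanced : forall v, lprefix v D <-> rprefix v D.

Local Notation S := (fun v => lprefix v D).

(** If D = u * y * r with y = u^-1 * z and lengths adding up, then y * r is a
suffix of D, hence a prefix because D is balanced, and y is a prefix of it.
This is what lets a configuration above u be translated down to 1. *)
Lemma lprefix_balanced_factor u z : lprefix u z -> lprefix z D -> S (u^-1 * z).
Proof.
move=> uz zD; have uD := lprefix_trans uz zD.
have suffix : lprefix (u^-1 * D) D.
  by apply/balanced; rewrite /rprefix invgM invgK mulVKg.
by apply: lprefix_trans suffix; apply/lprefix_shift.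
Qed.

Variable atom : gT -> Prop.
Hypothesis descent : forall v, v != 1 -> exists2 s, atom s & lprefix s v.
Hypothesis atom1 : forall s, atom s -> s <> 1.
Hypothesis atom_join : forall s t, atom s -> atom t -> s <> t -> S s -> S t ->
  exists m, is_join_in S lprefix s t m.

Lemma atom_step u a : lprefix u a -> u <> a ->
  exists s, [/\ atom s, lprefix u (u * s) & lprefix (u * s) a].
Proof.
move=> ua neq_ua; have [|s atom_s sua] := @descent (u^-1 * a).
  by apply/eqP=> /(congr1 (mulg u)); rewrite mulVKg mulg1 => /esym.
by have [? ?] := lprefix_mul ua sua; exists s; split.
Qed.

(** The translate by u of the join of s and t: everything above u * s and u * t
translates down into the interval, where it lies above s and t. *)
Lemma join_atoms_above u s t : atom s -> atom t ->
    lprefix u (u * s) -> S (u * s) -> lprefix u (u * t) -> S (u * t) ->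
  exists m, is_join_in S lprefix (u * s) (u * t) m.
Proof.
move=> atom_s atom_t us usD ut utD.
have uD := lprefix_trans us usD.
have [->|/eqP neq_st] := eqVneq s t.
  by exists (u * t); split=> //; apply: lprefix_refl.
have Ss : S s by rewrite -(mulKg u s); apply: lprefix_balanced_factor.
have St : S t by rewrite -(mulKg u t); apply: lprefix_balanced_factor.
have [m [mD sm tm m_min]] := atom_join atom_s atom_t neq_st Ss St.
have above z : S z -> lprefix (u * s) z -> lprefix (u * t) z ->
  lprefix u (u * m) /\ lprefix (u * m) z.
  move=> zD usz utz; have uz := lprefix_trans us usz.
  apply: lprefix_mul => //; apply: m_min.
  - exact: lprefix_balanced_factor.
  - by rewrite -(mulKg u s); apply/lprefix_shift.
  - by rewrite -(mulKg u t); apply/lprefix_shift.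
have [um umD] := above D (lprefix_refl D) usD utD.
exists (u * m); split=> //.
- by apply/(lprefix_shift us um); rewrite !mulKg.
- by apply/(lprefix_shift ut um); rewrite !mulKg.
by move=> z zD usz utz; have [] := above z zD usz utz.
Qed.

(** Induction on the distance from u to D.  Let u * s and u * t be first steps
from u towards a and b, and let c be their join.  The induction hypothesis
above u * s yields the join d of a and c, then above u * t the join of d and b;
anything above a and b is above c, hence above d, hence above that last join. *)
Lemma join_above u a b : S a -> S b -> lprefix u a -> lprefix u b ->
  exists j, is_join_in S lprefix a b j.
Proof.
have [N] := ubnP (L D - L u); elim: N u a b => // N IHN u a b.
rewrite ltnS => leN aD bD ua ub.
have [<-|/eqP neq_ua] := eqVneq u a.
  by exists b; split=> //; [exact: lprefix_refl].
have [<-|/eqP neq_ub] := eqVneq u b.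
  by exists a; split=> //; [exact: lprefix_refl].
have [s [atom_s us usa]] := atom_step ua neq_ua.
have [t [atom_t ut utb]] := atom_step ub neq_ub.
have IH s' a' b' : atom s' -> lprefix u (u * s') -> S a' -> S b' ->
    lprefix (u * s') a' -> lprefix (u * s') b' ->
  exists j, is_join_in S lprefix a' b' j.
  move=> atom_s' us' a'D b'D us'a us'b; apply: (IHN (u * s')) => //.
  have := lprefix_leq (lprefix_trans us'a a'D).
  have : L s' != 0%N by apply/eqP=> /L_eq0; apply: atom1.
  by move: us'; rewrite /lprefix mulKg; lia.
have usD := lprefix_trans usa aD; have utD := lprefix_trans utb bD.
have [c [cD usc utc c_min]] := join_atoms_above atom_s atom_t us usD ut utD.
have [d [dD ad cd d_min]] := IH s a c atom_s us aD cD usa usc.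
have [|j [jD dj bj j_min]] := IH t d b atom_t ut dD bD _ utb.
  exact: lprefix_trans utc cd.
exists j; split=> //; first exact: lprefix_trans ad dj.
move=> z zD az bz; apply: j_min => //; apply: d_min => //; apply: c_min => //.
- exact: lprefix_trans usa az.
- exact: lprefix_trans utb bz.
Qed.

(** A common lower bound of maximal length absorbs every other one, since their
join is again a common lower bound. *)
Lemma meet_of_joins a b : S a -> S b ->
    (forall c d, S c -> S d -> exists j, is_join_in S lprefix c d j) ->
  exists m, is_meet_in S lprefix a b m.
Proof.
move=> aD bD joins.
pose lower l := `[< exists c, [/\ lprefix c a, lprefix c b & L c = l] >].
have exl : exists l, lower l.
  by exists 0%N; apply/asboolP; exists 1; split=> //; apply: lprefix1.
have bound l : lower l -> (l <= L a)%N.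
  by move=> /asboolP[c [ca _ <-]]; apply: lprefix_leq.
case: (ex_maxnP exl bound) => l /asboolP[m [ma mb Lm]] l_max.
have mD := lprefix_trans ma aD.
exists m; split=> // c cD ca cb.
have [j [jD cj mj j_min]] := joins c m cD mD.
have mE : m = j.
  apply: lprefix_leq_eq => //; rewrite Lm; apply/l_max/asboolP.
  by exists j; split=> //; apply: j_min.
by rewrite mE.
Qed.

Theorem balanced_interval_lattice : is_lattice_on S lprefix.
Proof.
have joins a b : S a -> S b -> exists j, is_join_in S lprefix a b j.
  by move=> aD bD; apply: (join_above aD bD (lprefix1 a) (lprefix1 b)).
split; last by move=> a b aD bD; split; [exact: meet_of_joins | exact: joins].
split=> [a _ | a b _ _ | a b c _ _ _]; first exact: lprefix_refl.
  exact: lprefix_anti.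
exact: lprefix_trans.
Qed.

Theorem balanced_interval_lattice_r : is_lattice_on S rprefix.
Proof.
apply: (@is_lattice_on_image gT gT S (fun a b => lprefix b a) S rprefix
  (fun v => v^-1 * D)).
- move=> y; split=> [/balanced Sy | [x xD <-]].
    exists (D * y^-1); last by rewrite invgM invgK mulgVK.
    by rewrite /lprefix invgM invgK mulgVK.
  by apply/balanced; rewrite /rprefix invgM invgK mulVKg.
- have quot (x y : gT) : (y^-1 * D) * (x^-1 * D)^-1 = y^-1 * x.
    by rewrite invgM invgK mulgA mulgK.
  by rewrite /lprefix /rprefix => x y xD yD; rewrite quot; split; lia.
- exact: (is_lattice_on_opp balanced_interval_lattice).
Qed.

End BalancedInterval.

(** * The group of exponent-labelled permutations *)

(** Row i of the monomial matrix has its nonzero entry x ^ (mdata.2 i) in column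
mdata.1 i; the exponents add up to 0 because the entries have product 1. *)
Record monomial (n : nat) := Monomial {
  mdata : 'S_n * {ffun 'I_n -> int};
  mdata_sum0 : \sum_i mdata.2 i == 0 }.

HB.instance Definition _ n := [isSub for @mdata n].
HB.instance Definition _ n := [Choice of monomial n by <:].

Section MonomialGroup.
Variable n : nat.
Implicit Types (u v w z : monomial n) (i j b c d : 'I_n).

Definition mcol v : 'S_n := (mdata v).1.
Definition expo v : {ffun 'I_n -> int} := (mdata v).2.

Lemma expo_sum v : \sum_i expo v i = 0.
Proof. exact/eqP/mdata_sum0. Qed.

Lemma monomialP v w : mcol v = mcol w -> expo v =1 expo w -> v = w.
Proof.
move=> eq_col /ffunP eq_expo; apply: val_inj.
rewrite [LHS]surjective_pairing [RHS]surjective_pairing.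
by congr pair.
Qed.

Lemma mono_one_sum : \sum_i [ffun _ : 'I_n => 0 : int] i == 0.
Proof. by rewrite big1 // => i _; rewrite ffunE. Qed.

Lemma mono_mul_sum v w :
  \sum_i [ffun i => expo v i + expo w (mcol v i)] i == 0.
Proof.
apply/eqP; under eq_bigr do rewrite ffunE.
rewrite big_split /= expo_sum add0r -[RHS](expo_sum w).
by rewrite [RHS](reindex_perm (mcol v)).
Qed.

Lemma mono_inv_sum v : \sum_i [ffun i => - expo v ((mcol v)^-1%g i)] i == 0.
Proof.
apply/eqP; under eq_bigr do rewrite ffunE.
apply/eqP; rewrite sumrN oppr_eq0 -[X in _ == X](expo_sum v).
by rewrite [X in _ == X](reindex_perm (mcol v)^-1%g).
Qed.

Definition mono_one : monomial n := @Monomial n (1%g, _) mono_one_sum.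
Definition mono_mul v w : monomial n :=
  @Monomial n ((mcol v * mcol w)%g, _) (mono_mul_sum v w).
Definition mono_inv v : monomial n :=
  @Monomial n ((mcol v)^-1%g, _) (mono_inv_sum v).

Lemma mono_mulA : associative mono_mul.
Proof.
move=> u v w; apply: monomialP => [|i]; first by rewrite /mcol /= mulgA.
by rewrite /expo /= !ffunE /= /mcol /= permM addrA.
Qed.

Lemma mono_mul1 : left_id mono_one mono_mul.
Proof.
move=> v; apply: monomialP => [|i]; first by rewrite /mcol /= mul1g.
by rewrite /expo /= !ffunE /= /mcol /= perm1 add0r.
Qed.

Lemma mono_mulr1 : right_id mono_one mono_mul.
Proof.
move=> v; apply: monomialP => [|i]; first by rewrite /mcol /= mulg1.
by rewrite /expo /= !ffunE /= addr0.
Qed.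

Lemma mono_mulV : left_inverse mono_one mono_inv mono_mul.
Proof.
move=> v; apply: monomialP => [|i]; first by rewrite /mcol /= mulVg.
by rewrite /expo /= !ffunE /= /mcol /= addNr.
Qed.

Lemma mono_mulrV : right_inverse mono_one mono_inv mono_mul.
Proof.
move=> v; apply: monomialP => [|i]; first by rewrite /mcol /= mulgV.
by rewrite /expo /= !ffunE /= /mcol /= permK addrN.
Qed.

End MonomialGroup.

HB.instance Definition _ n := isGroup.Build (monomial n) (@mono_mulA n)
  (@mono_mul1 n) (@mono_mulr1 n) (@mono_mulV n) (@mono_mulrV n).

(** * Length as a sum over pairs of rows *)

Section PairStates.
Variable n : nat.
Implicit Types (u v w z : monomial n) (i j b c d : 'I_n).

Lemma expo1 i : expo (1%g : monomial n) i = 0.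
Proof. by rewrite /expo /= ffunE. Qed.

Lemma mcolM v w i : mcol (v * w)%g i = mcol w (mcol v i).
Proof. by rewrite /mcol /= permM. Qed.

Lemma expoM v w i : expo (v * w)%g i = expo v i + expo w (mcol v i).
Proof. by rewrite /expo /= ffunE. Qed.

Lemma mcolV v : mcol (v^-1)%g = (mcol v)^-1%g. Proof. by []. Qed.

Lemma expoV v i : expo (v^-1)%g i = - expo v ((mcol v)^-1%g i).
Proof. by rewrite /expo /= ffunE. Qed.

(** The label is the exponent of the row whose entry is further to the right: to
clear that exponent, the entry has to be carried past the other one, towards
the first column, where the generators t_p change exponents. *)
Definition pair_state v j i : bool * int :=
  if (mcol v i < mcol v j)%N then (true, expo v j) else (false, expo v i).

(** The graph metric of the complete bipartite graph between the states of the
two flags. *)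
Definition state_dist (p q : bool * int) : nat :=
  if p.1 == q.1 then (p.2 != q.2).*2 else 1.

Definition mono_dist v w : nat :=
  \sum_(r : 'I_n * 'I_n | (r.1 < r.2)%N)
    state_dist (pair_state v r.1 r.2) (pair_state w r.1 r.2).

Definition mono_len v : nat := mono_dist 1%g v.

Lemma state_dist_triangle p q r :
  (state_dist p r <= state_dist p q + state_dist q r)%N.
Proof.
case: p q r => [e a] [f b] [g c]; rewrite /state_dist /=.
have : ((a != c) <= (a != b) + (b != c))%N by case: (eqVneq a b) => [->|]; lia.
by case: e f g => [] [] [] //=; lia.
Qed.

Lemma state_dist_eq0 p q : (state_dist p q == 0%N) = (p == q).
Proof.
case: p q => [[] a] [[] b]; rewrite /state_dist /= ?xpair_eqE //=;
  by case: (a == b).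
Qed.

Lemma state_distC p q : state_dist p q = state_dist q p.
Proof. by rewrite /state_dist eq_sym [p.2 == _]eq_sym. Qed.

Lemma state_dist_swap v w j i : j != i ->
  state_dist (pair_state v j i) (pair_state w j i) =
  state_dist (pair_state v i j) (pair_state w i j).
Proof.
move=> neq_ji; rewrite /pair_state.
have col_neq u : (mcol u j == mcol u i :> nat) = false.
  by rewrite val_eqE (inj_eq perm_inj) (negbTE neq_ji).
by case: (ltngtP (mcol v j) (mcol v i)) (col_neq v) => // _ _;
  case: (ltngtP (mcol w j) (mcol w i)) (col_neq w).
Qed.

(** Both flags are those of v and w on the rows mcol u j and mcol u i, and labels
under equal flags are shifted by the exponent of u on the same row. *)
Lemma state_distM u v w j i :
  state_dist (pair_state (u * v)%g j i) (pair_state (u * w)%g j i) =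
  state_dist (pair_state v (mcol u j) (mcol u i))
    (pair_state w (mcol u j) (mcol u i)).
Proof.
rewrite /pair_state !mcolM !expoM.
by do 2!case: ifP => _; rewrite /state_dist //= (inj_eq (addrI _)).
Qed.

(** Twice either side is the sum over all ordered pairs of distinct rows, which
a permutation merely reindexes. *)
Lemma sum_pairs_perm (g : 'I_n -> 'I_n -> nat) (s : 'S_n) :
    (forall j i, j != i -> g j i = g i j) ->
  \sum_(r : 'I_n * 'I_n | (r.1 < r.2)%N) g (s r.1) (s r.2) =
  \sum_(r : 'I_n * 'I_n | (r.1 < r.2)%N) g r.1 r.2.
Proof.
move=> gC; apply: double_inj; rewrite -!addnn.
have dbl (h : 'I_n -> 'I_n -> nat) : (forall j i, j != i -> h j i = h i j) ->
    (\sum_(r : 'I_n * 'I_n | r.1 < r.2) h r.1 r.2 +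
     \sum_(r : 'I_n * 'I_n | r.1 < r.2) h r.1 r.2)%N =
    (\sum_(r : 'I_n * 'I_n | r.1 != r.2) h r.1 r.2)%N.
  move=> hC; pose sw (r : 'I_n * 'I_n) := (r.2, r.1).
  have swK : involutive sw by case.
  rewrite {2}(reindex_inj (inv_inj swK)) /=.
  rewrite [RHS](bigID (fun r : 'I_n * 'I_n => (r.1 < r.2)%N)) /=; congr addn.
    by apply: eq_bigl => -[j i]; rewrite /= -val_eqE; case: ltngtP.
  apply: congr_big => [//|[j i]|[j i]] /=; last first.
    by rewrite ltn_neqAle => /andP[] /hC.
  by rewrite -val_eqE /=; case: ltngtP.
rewrite (dbl g) // (dbl (fun j i => g (s j) (s i))) => [|j i neq_ji]; last first.
  by rewrite gC // (inj_eq perm_inj).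
pose sp (r : 'I_n * 'I_n) := (s r.1, s r.2).
have sp_inj : injective sp by case=> [j i] [j' i'] [/perm_inj-> /perm_inj->].
rewrite [RHS](reindex_inj sp_inj) /=.
by apply: eq_bigl => -[j i]; rewrite /= (inj_eq perm_inj).
Qed.

Lemma mono_distM u v w : mono_dist (u * v)%g (u * w)%g = mono_dist v w.
Proof.
rewrite /mono_dist; under eq_bigr do rewrite state_distM.
rewrite (@sum_pairs_perm (fun j i =>
  state_dist (pair_state v j i) (pair_state w j i))) //.
exact: state_dist_swap.
Qed.

Lemma mono_lenV v w : mono_len (v^-1 * w)%g = mono_dist v w.
Proof. by rewrite /mono_len -(mono_distM v) mulg1 mulVKg. Qed.

Lemma mono_len1 : mono_len 1%g = 0%N.
Proof.
by rewrite /mono_len /mono_dist big1 // => r _; apply/eqP; rewrite state_dist_eq0.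
Qed.

Lemma mono_len_inv v : mono_len v^-1%g = mono_len v.
Proof.
rewrite -[in LHS](mulg1 v^-1%g) mono_lenV /mono_len /mono_dist.
by apply: eq_bigr => r _; apply: state_distC.
Qed.

Lemma mono_len_mul v w : (mono_len (v * w)%g <= mono_len v + mono_len w)%N.
Proof.
have -> : mono_len w = mono_dist v (v * w)%g.
  by rewrite -mono_lenV mulKg.
by rewrite -big_split; apply: leq_sum => r _; apply: state_dist_triangle.
Qed.

(** The triangle inequality through v holds pair by pair, so it is an equality
of sums only if it is one on every pair. *)
Lemma lprefix_pairs v w :
  lprefix mono_len v w <-> forall j i, (j < i)%N ->
    (state_dist (pair_state 1%g j i) (pair_state v j i) +
     state_dist (pair_state v j i) (pair_state w j i))%N =
    state_dist (pair_state 1%g j i) (pair_state w j i).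
Proof.
rewrite /lprefix mono_lenV /mono_len -big_split /=.
split=> [eq_len|eq_pairs]; last by apply: eq_bigr => -[j i]; apply: eq_pairs.
pose dist1 u (r : 'I_n * 'I_n) :=
  state_dist (pair_state 1%g r.1 r.2) (pair_state u r.1 r.2).
pose via r := (dist1 v r +
  state_dist (pair_state v r.1 r.2) (pair_state w r.1 r.2))%N.
have [|_ eq_sums] := @leqif_sum _ (fun r : 'I_n * 'I_n => (r.1 < r.2)%N)
    (fun r => dist1 w r == via r) (dist1 w) via.
  by move=> r _; split=> //; apply: state_dist_triangle.
move: eq_sums; rewrite [LHS](_ : _ = true); last exact/eqP/esym/eq_len.
move=> /esym/forall_inP eq_pairs j i lt_ji.
by have /eqP := eq_pairs (j, i) lt_ji.
Qed.

End PairStates.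

(** * The generators *)

Section Reflections.
Variable n : nat.
Implicit Types (u v w z : monomial n) (i j b c d : 'I_n) (p q k : int).

Definition reflection_expo b c p : {ffun 'I_n -> int} :=
  [ffun i => p *+ (i == c) - p *+ (i == b)].

Lemma reflection_sum b c p : \sum_i reflection_expo b c p i == 0.
Proof.
under eq_bigr do rewrite ffunE !mulrb.
by rewrite sumrB -!big_mkcond !big_pred1_eq subrr.
Qed.

(** On adjacent rows b and c, this is t_p if b is the first row, and with p = 0
the permutation matrix of the transposition (b, c). *)
Definition reflection b c p : monomial n :=
  @Monomial n (tperm b c, _) (reflection_sum b c p).

Lemma col_reflection b c p : mcol (reflection b c p) = tperm b c.
Proof. by []. Qed.

Lemma expo_reflection b c p i :
  expo (reflection b c p) i = p *+ (i == c) - p *+ (i == b).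
Proof. by rewrite /expo ffunE. Qed.

Lemma reflection_colM b c p z i :
  mcol (reflection b c p * z)%g i = mcol z (tperm b c i).
Proof. by rewrite mcolM. Qed.

Lemma reflection_expoM b c p z i :
  expo (reflection b c p * z)%g i =
  p *+ (i == c) - p *+ (i == b) + expo z (tperm b c i).
Proof. by rewrite expoM expo_reflection. Qed.

Lemma reflection_sqr b c p : (reflection b c p * reflection b c p)%g = 1%g.
Proof.
apply: monomialP => [|i]; first by apply/permP=> i; rewrite !mcolM tpermK perm1.
rewrite reflection_expoM expo_reflection expo1.
case: tpermP => [->|->|/eqP/negbTE-> /eqP/negbTE->]; last by rewrite subrr.
  by rewrite !eqxx [c == b]eq_sym; ring.
by rewrite !eqxx [c == b]eq_sym; ring.
Qed.

Lemma reflectionV b c p : (reflection b c p)^-1%g = reflection b c p.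
Proof. exact/mulg1_eq/reflection_sqr. Qed.

Definition adjacent b c p := (c = b.+1 :> nat) /\ ((0 < b)%N -> p = 0).

Definition atom z := exists b c p, adjacent b c p /\ z = reflection b c p.

Lemma tperm_val b c i :
  tperm b c i = (if i == b :> nat then c : nat else
                 if i == c :> nat then b : nat else i) :> nat.
Proof.
case: tpermP => [->|->|ib ic]; rewrite ?eqxx //; first by case: eqP.
by do 2!case: eqP => [/val_inj //|_].
Qed.

Lemma reflection_state b c p j i : adjacent b c p -> (j < i)%N ->
  pair_state (reflection b c p) j i =
  if (j == b) && (i == c) then (true, - p) else (false, 0).
Proof.
move=> [cb p0] lt_ji; rewrite /pair_state col_reflection !expo_reflection.
rewrite !tperm_val -!val_eqE /=.
have [/andP[/eqP-> /eqP->]|nbc] := boolP ((j == b :> nat) && (i == c :> nat)).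
  by rewrite cb !eqxx (gtn_eqF (ltnSn b)) (ltn_eqF (ltnSn b)) ltnSn sub0r.
have -> : ((if i == b :> nat then c : nat else
            if i == c :> nat then b : nat else i) <
           (if j == b :> nat then c : nat else
            if j == c :> nat then b : nat else j))%N = false.
  by move: nbc lt_ji; rewrite cb; do ?case: ifP => //; lia.
congr pair; have [b0|/p0->] := posnP b; last by rewrite !mul0rn subrr.
have -> : (i == c :> nat) = false by move: nbc lt_ji; rewrite cb b0; lia.
have -> : (i == b :> nat) = false by move: lt_ji; rewrite b0; lia.
by rewrite subrr.
Qed.

Lemma reflection_len b c p : adjacent b c p -> mono_len (reflection b c p) = 1%N.
Proof.
move=> adj; have [cb _] := adj; rewrite /mono_len /mono_dist.
rewrite (bigD1 (b, c)) /=; last by rewrite cb.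
rewrite big1 => [|[j i] /andP[/= lt_ji neq]].
  rewrite reflection_state ?cb // !eqxx /pair_state !perm1 cb /state_dist /=.
  by rewrite ltnNge leqnSn.
rewrite reflection_state // -xpair_eqE (negbTE neq).
by apply/eqP; rewrite state_dist_eq0 /pair_state !perm1 ltnNge ltnW //= expo1.
Qed.

Lemma one_state j i : (j < i)%N -> pair_state (1%g : monomial n) j i = (false, 0).
Proof. by move=> lt_ji; rewrite /pair_state !perm1 ltnNge ltnW //= expo1. Qed.

(** The condition that the state (true, - p) lies on a geodesic from (false, 0),
the state of 1, to the state of z on the rows b and c: z must agree with
it if inverted there, and must have left the bottom state otherwise. *)
Definition above_reflection z b c p : bool :=
  if (mcol z c < mcol z b)%N then expo z b == - p else expo z c != 0.

Lemma reflection_lprefix z b c p : adjacent b c p ->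
  lprefix (@mono_len n) (reflection b c p) z <-> above_reflection z b c p.
Proof.
move=> adj; have [cb _] := adj.
have key : (state_dist (false, 0%R) (true, (- p)%R) +
    state_dist (true, (- p)%R) (pair_state z b c))%N =
    state_dist (false, 0%R) (pair_state z b c) <-> above_reflection z b c p.
  rewrite /above_reflection /pair_state /state_dist.
  case: (mcol z c < mcol z b)%N => /=.
    by rewrite eq_sym; case: (expo z b == - p); split.
  by rewrite eq_sym; case: (expo z c == 0); split.
rewrite lprefix_pairs -key; split=> [eq_pairs | eq_bc j i lt_ji].
  have lt_bc : (b < c)%N by rewrite cb.
  by have := eq_pairs b c lt_bc; rewrite reflection_state // !eqxx one_state.
rewrite reflection_state // one_state //.
by case: ifP => // /andP[/eqP-> /eqP->].
Qed.

Lemma reflection_quot_len z b c p : adjacent b c p -> above_reflection z b c p ->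
  (mono_len z = (mono_len (reflection b c p * z)%g).+1)%N.
Proof.
move=> adj /(reflection_lprefix _ adj).
by rewrite /lprefix reflectionV reflection_len // add1n => ->.
Qed.

Lemma increasing_perm_id (s : 'S_n) :
  (forall b c, c = b.+1 :> nat -> (s b < s c)%N) -> s = 1%g.
Proof.
move=> s_incr.
have le_s i : (i <= s i)%N.
  case: i => m; elim: m => // m IHm lt_mn; have lt_mn' := ltnW lt_mn.
  apply: leq_ltn_trans (IHm lt_mn') _.
  exact: (s_incr (Ordinal lt_mn') (Ordinal lt_mn)).
(* A permutation preserves the sum of all indices. *)
have [|_ /esym] := @leqif_sum _ predT (fun i => (i : nat) == s i)
    (@nat_of_ord n) (fun i => s i).
  by move=> i _; split; first exact: le_s.
rewrite [X in X == _](reindex_perm s) eqxx => /forallP eq_s.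
by apply/permP=> i; rewrite perm1; apply/val_inj/esym/eqP/eq_s.
Qed.

(** If no generator is a prefix of v, then going down the rows, each row has its
entry to the right of the previous one and, except for the first, exponent 0:
at rows b and b + 1 the exponent of b is the one that a generator would
have to match, either because it is 0 or because p is free at the first row.
The first exponent then vanishes as well since the sum is 0. *)
Lemma atom_descent v : v != 1%g -> exists2 s, atom s & lprefix (@mono_len n) s v.
Proof.
apply: contra_neqP => no_atom.
have none b c p : adjacent b c p -> above_reflection v b c p = false.
  move=> adj; apply/negbTE/negP => /(reflection_lprefix _ adj) sv.
  by apply: no_atom; exists (reflection b c p) => //; exists b, c, p.
have incr m b c : b = m :> nat -> c = b.+1 :> nat ->
    (mcol v b < mcol v c)%N /\ expo v c = 0.
  elim: m b c => [|m IHm] b c bm cb.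
    (* On the first two rows, take the generator that matches v if inverted. *)
    have adj : adjacent b c (- expo v b) by split=> //; rewrite bm.
    have := none b c _ adj; rewrite /above_reflection opprK eqxx.
    case: ltngtP => // [_ /negbFE/eqP //|/val_inj/perm_inj bc].
    by move: cb; rewrite bc; lia.
  have lt_mn : (m < n)%N by have := ltn_ord b; lia.
  have [_ b0] := IHm (Ordinal lt_mn) b erefl bm.
  have adj : adjacent b c 0 by [].
  have := none b c _ adj; rewrite /above_reflection b0 oppr0 eqxx.
  case: ltngtP => // [_ /negbFE/eqP //|/val_inj/perm_inj bc].
  by move: cb; rewrite bc; lia.
have colv : mcol v = 1%g.
  by apply: increasing_perm_id => b c cb; have [] := incr b b c erefl cb.
have expo0 i : (0 < i)%N -> expo v i = 0.
  case: i => [[|m] lt_mn] //= _.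
  by have [] := incr m (Ordinal (ltnW lt_mn)) (Ordinal lt_mn) erefl erefl.
apply: monomialP => // i; rewrite expo1.
have [/expo0 //|] := ltnP 0 i; rewrite leqn0 => /eqP i0.
have := expo_sum v; rewrite (bigD1 i) //= big1 ?addr0 // => j neq_ji.
by apply: expo0; rewrite lt0n -i0.
Qed.

End Reflections.

(** * The interval below a power of lambda *)

Section LambdaInterval.
Variable n : nat.
Implicit Types (u v w z s t m : monomial n) (i j b c d : 'I_n) (p q k : int).
Local Notation len := (@mono_len n).

(** On the first row this is - (n - 1) * k. *)
Definition lambda_expo k : {ffun 'I_n -> int} :=
  [ffun i : 'I_n => k - (k *+ n) *+ (i == 0%N :> nat)].

Lemma lambda_sum k : \sum_i lambda_expo k i == 0.
Proof.
under eq_bigr do rewrite ffunE.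
rewrite sumrB sumr_const card_ord; case: (posnP n) => [n0|n_gt0].
  by rewrite n0 mulr0n big1 ?subr0 // => i _; rewrite mul0rn.
rewrite (bigD1 (Ordinal n_gt0)) //= big1 ?addr0 ?subrr // => i.
by rewrite -val_eqE /= => /negbTE->.
Qed.

Definition mono_lambda k : monomial n := @Monomial n (1%g, _) (lambda_sum k).

Lemma expo_lambda k i : expo (mono_lambda k) i = k - (k *+ n) *+ (i == 0%N :> nat).
Proof. by rewrite /expo ffunE. Qed.

Lemma mono_lambdaD k l : mono_lambda (k + l) = (mono_lambda k * mono_lambda l)%g.
Proof.
apply: monomialP => [|i]; first by rewrite /mcol /= mulg1.
rewrite expoM !expo_lambda perm1; case: (_ == _) => /=; last by rewrite !subr0.
by rewrite mulrnDl; ring.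
Qed.

Lemma mono_lambda0 : mono_lambda 0 = 1%g.
Proof.
by apply: monomialP => // i; rewrite expo_lambda expo1 !mul0rn subrr.
Qed.

Lemma mono_lambdaN k : mono_lambda (- k) = (mono_lambda k)^-1%g.
Proof.
by symmetry; apply: mulg1_eq; rewrite -mono_lambdaD subrr mono_lambda0.
Qed.

Lemma lambda_state k j i : (j < i)%N -> pair_state (mono_lambda k) j i = (false, k).
Proof.
move=> lt_ji; rewrite /pair_state !perm1 ltnNge (ltnW lt_ji) /= expo_lambda.
by have -> : (i == 0%N :> nat) = false by [lia]; rewrite mulr0n subr0.
Qed.

(** The top state on each pair is (false, k), at distance 2 from the bottom
state (false, 0): inverted states are all halfway between the two, while among
the others only the two ends lie on a geodesic. *)
Lemma lprefix_lambda k v : k != 0 ->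
  lprefix len v (mono_lambda k) <-> forall j i, (j < i)%N ->
    (mcol v j < mcol v i)%N -> expo v i = 0 \/ expo v i = k.
Proof.
move=> k_neq0; rewrite lprefix_pairs; split=> vP j i lt_ji.
  move=> lt_v; have := vP j i lt_ji.
  rewrite one_state // lambda_state // /pair_state ltnNge (ltnW lt_v) /=.
  rewrite /state_dist /= [0 == k]eq_sym (negbTE k_neq0).
  case: (eqVneq (expo v i) 0) => [|_]; first by left.
  by case: (eqVneq (expo v i) k) => [|_]; first by right.
have := vP j i lt_ji; rewrite one_state // lambda_state // /pair_state.
rewrite /state_dist; case: ltngtP => [lt_v /(_ isT)|_ _|/val_inj/perm_inj ji] /=.
- by rewrite [0 == k]eq_sym (negbTE k_neq0) => -[]->;
    rewrite !eqxx ?[0 == k]eq_sym (negbTE k_neq0).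
- by rewrite [0 == k]eq_sym (negbTE k_neq0).
- by move: lt_ji; rewrite ji ltnn.
Qed.

(** Inversion turns suffixes of lambda^k into prefixes of lambda^-k, exchanges
rows with columns and negates exponents; the pairs that [lprefix_lambda]
constrains, those increasing in both rows and columns, are preserved. *)
Lemma lambda_balanced k v : k != 0 ->
  lprefix len v (mono_lambda k) <-> rprefix len v (mono_lambda k).
Proof.
move=> k_neq0.
have -> : rprefix len v (mono_lambda k) = lprefix len v^-1%g (mono_lambda (- k)).
  rewrite /rprefix /lprefix mono_lambdaN !mono_len_inv.
  by rewrite -(mono_len_inv (mono_lambda k * v^-1)%g) invgM addnC.
rewrite !lprefix_lambda ?oppr_eq0 //; split=> vP j i lt_ji lt_v.
  have := vP ((mcol v)^-1%g j) ((mcol v)^-1%g i) lt_v.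
  by rewrite !permKV expoV => /(_ lt_ji) [] ->; [left; rewrite oppr0 | right].
have := vP (mcol v j) (mcol v i) lt_v; rewrite mcolV !permK expoV permK.
by move=> /(_ lt_ji)[/eqP|/oppr_inj]; [rewrite oppr_eq0 => /eqP; left | right].
Qed.

(** Holds by conversion; it expresses [lprefix] through the operations of
[monomial n] rather than those of an abstract group. *)
Lemma mono_lprefixE v w : lprefix len v w = (len v + len (v^-1 * w)%g = len w)%N.
Proof. by []. Qed.

(** A criterion bounding all lengths in terms of r; its last hypothesis, at
z = D, forces the bounds on m to be equalities. *)
Lemma is_join_of_length (D s t m : monomial n) (r : nat) :
    len s = 1%N -> len t = 1%N ->
    (len (s^-1 * m)%g < r)%N -> (len (t^-1 * m)%g < r)%N ->
    lprefix len s D -> lprefix len t D ->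
    (forall z, lprefix len z D -> lprefix len s z -> lprefix len t z ->
       (len (m^-1 * z)%g + r <= len z)%N) ->
  is_join_in (fun z => lprefix len z D) (lprefix len) s t m.
Proof.
move=> len_s len_t len_sm len_tm sD tD above.
have path1 u w : (len w <= len u + len (u^-1 * w)%g)%N.
  exact: (length_path1 (@mono_len_mul n)).
have below z : lprefix len z D -> lprefix len s z -> lprefix len t z ->
    lprefix len m z /\ len m = r.
  move=> zD sz tz; have := above z zD sz tz; have := path1 m z; have := path1 s m.
  by rewrite mono_lprefixE; lia.
have DD : lprefix len D D := lprefix_refl (@mono_len1 n) D.
have [mD len_m] := below D DD sD tD.
have := path1 s m; have := path1 t m.
split=> //; rewrite ?mono_lprefixE; try lia.
by move=> z zD sz tz; have [] := below z zD sz tz.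
Qed.

(** Distinct t_p and t_q cannot both match an inverted pair, so z above both has
exponent k on the second row.  Whatever p is, t_p t_(p-k) is the diagonal matrix
diag(x^-k, x^k, 1, ..., 1), which is therefore the join. *)
Lemma join_same_pair k b c p q : k != 0 ->
    adjacent b c p -> adjacent b c q -> p <> q ->
    lprefix len (reflection b c p) (mono_lambda k) ->
    lprefix len (reflection b c q) (mono_lambda k) ->
  exists m, is_join_in (fun z => lprefix len z (mono_lambda k)) (lprefix len)
    (reflection b c p) (reflection b c q) m.
Proof.
move=> k_neq0 adjp adjq neq_pq pD qD; have [cb p0] := adjp.
(* Two exponents can only occur at the first pair of rows. *)
have b0 : b = 0%N :> nat.
  by case: (posnP b) => // b_gt0; case: neq_pq; rewrite p0 // (adjq.2 b_gt0).
have neq_bc : (b == c) = false by rewrite -val_eqE /= cb; lia.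
have adj l : adjacent b c l by split=> //; rewrite b0.
have mE : (reflection b c p * reflection b c (p - k) =
           reflection b c q * reflection b c (q - k))%g.
  apply: monomialP => [|i]; first by apply/permP=> i; rewrite !mcolM.
  rewrite !reflection_expoM !expo_reflection.
  case: tpermP => [->|->|/eqP/negbTE-> /eqP/negbTE->]; last by rewrite !mulr0n.
    by rewrite !eqxx neq_bc [c == b]eq_sym neq_bc; ring.
  by rewrite !eqxx neq_bc [c == b]eq_sym neq_bc; ring.
exists (reflection b c p * reflection b c (p - k))%g.
apply: (@is_join_of_length _ _ _ _ 2%N) => //; try by rewrite reflection_len.
- by rewrite mulKg reflection_len.
- by rewrite mE mulKg reflection_len.
move=> z /(lprefix_lambda _ k_neq0) zD /(reflection_lprefix _ adjp) pz.
move=> /(reflection_lprefix _ adjq) qz.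
rewrite (reflection_quot_len adjp pz).
have /(reflection_quot_len (adj (p - k)))-> :
    above_reflection (reflection b c p * z)%g b c (p - k).
  move: pz qz; rewrite /above_reflection !reflection_colM !reflection_expoM.
  rewrite tpermL tpermR.
  have lt_bc : (b < c)%N by rewrite cb.
  case: ltngtP => [_ /eqP-> /eqP /oppr_inj // | lt_z ec _ | /val_inj/perm_inj bc].
  - have [/eqP|->] := zD b c lt_bc lt_z; first by rewrite (negbTE ec).
    by rewrite eqxx neq_bc => /=; lia.
  - by move: neq_bc; rewrite bc eqxx.
by rewrite invgM !reflectionV -mulgA addn2.
Qed.

(** The two generators commute, and each leaves alone the rows that decide
whether the other is a prefix. *)
Lemma join_far k b c p b' c' q :
    adjacent b c p -> adjacent b' c' q -> (c < b')%N ->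
    lprefix len (reflection b c p) (mono_lambda k) ->
    lprefix len (reflection b' c' q) (mono_lambda k) ->
  exists m, is_join_in (fun z => lprefix len z (mono_lambda k)) (lprefix len)
    (reflection b c p) (reflection b' c' q) m.
Proof.
move=> adj adj' lt_cb' pD qD; have [cb p0] := adj; have [cb' q0] := adj'.
have q_eq0 : q = 0 by apply: q0; lia.
have fix_b i : (i < b')%N -> tperm b' c' i = i.
  by move=> lt_i; apply: tpermD; rewrite -val_eqE /= ?cb'; lia.
have fix_b' i : (c < i)%N -> tperm b c i = i.
  by move=> lt_i; apply: tpermD; rewrite -val_eqE /=; lia.
have off i : (c < i)%N -> ((i == c) = false) * ((i == b) = false).
  by move=> lt_i; split; rewrite -val_eqE /=; lia.
have mE : (reflection b c p * reflection b' c' q =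
           reflection b' c' q * reflection b c p)%g.
  apply: monomialP => [|i].
    apply/permP=> i; rewrite !mcolM; apply: val_inj; rewrite /= !tperm_val.
    by rewrite cb cb'; do ?case: ifP; lia.
  rewrite !reflection_expoM !expo_reflection q_eq0 !mul0rn !subrr addr0 add0r.
  have [le_ic|lt_ci] := leqP i c; first by rewrite fix_b //; lia.
  have lt_cti : (c < tperm b' c' i)%N by rewrite tperm_val; do ?case: ifP; lia.
  by rewrite !(off _ lt_ci) !(off _ lt_cti).
exists (reflection b c p * reflection b' c' q)%g.
apply: (@is_join_of_length _ _ _ _ 2%N) => //; try by rewrite reflection_len.
- by rewrite mulKg reflection_len.
- by rewrite mE mulKg reflection_len.
move=> z _ /(reflection_lprefix _ adj) pz /(reflection_lprefix _ adj') qz.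
rewrite (reflection_quot_len adj pz).
have /(reflection_quot_len adj')-> :
    above_reflection (reflection b c p * z)%g b' c' q.
  move: qz; rewrite /above_reflection !reflection_colM !reflection_expoM.
  have lt_cc' : (c < c')%N by lia.
  by rewrite !fix_b' // !(off _ lt_cb') !(off _ lt_cc') subrr !add0r.
by rewrite invgM !reflectionV -mulgA addn2.
Qed.

(** Both generators being prefixes of z, so are in turn t of s * z and s of
t * (s * z): the former is a transitivity property of the states of z on the
rows b < c < d, the latter is the hypothesis on t moved to the rows b and c. *)
Lemma join_braid k b c d p :
    adjacent b c p -> adjacent c d 0 ->
    lprefix len (reflection b c p) (mono_lambda k) ->
    lprefix len (reflection c d 0) (mono_lambda k) ->
  exists m, is_join_in (fun z => lprefix len z (mono_lambda k)) (lprefix len)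
    (reflection b c p) (reflection c d 0) m.
Proof.
move=> adj adj' pD qD; have [cb p0] := adj; have [dc _] := adj'.
set s := reflection b c p; set t := reflection c d 0.
have [/negbTE bc /negbTE bd /negbTE cd] : [/\ b != c, b != d & c != d].
  by rewrite -!val_eqE /= dc cb; split; lia.
have neq := (bc, bd, cd, (eq_sym c b, eq_sym d b, eq_sym d c)).
have tb : tperm c d b = b by rewrite tpermD // eq_sym ?bc ?bd.
have td : tperm b c d = d by rewrite tpermD // ?bd ?cd.
have mE : (s * (t * s) = t * (s * t))%g.
  apply: monomialP => [|i].
    apply/permP=> i; rewrite !mcolM; apply: val_inj; rewrite /= !tperm_val.
    by rewrite dc cb; do ?case: ifP; lia.
  rewrite !reflection_expoM !expo_reflection !mul0rn !subrr !add0r addr0.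
  have [->|ib] := eqVneq i b.
    by rewrite !(tb, td, tpermL, tpermR) !(neq, eqxx); ring.
  have [->|ic] := eqVneq i c.
    by rewrite !(tb, td, tpermL, tpermR) !(neq, eqxx); ring.
  have [->|id] := eqVneq i d.
    by rewrite !(tb, td, tpermL, tpermR) !(neq, eqxx); ring.
  have ti : (tperm b c i = i) * (tperm c d i = i) by rewrite !tpermD // eq_sym.
  by rewrite !ti (negbTE ib) (negbTE ic) subrr.
exists (s * (t * s))%g.
apply: (@is_join_of_length _ _ _ _ 3%N) => //; try by rewrite reflection_len.
- rewrite mulKg; apply: leq_ltn_trans (mono_len_mul _ _) _.
  by rewrite !reflection_len.
- rewrite mE mulKg; apply: leq_ltn_trans (mono_len_mul _ _) _.
  by rewrite !reflection_len.
move=> z _ /(reflection_lprefix _ adj) sz /(reflection_lprefix _ adj') tz.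
rewrite (reflection_quot_len adj sz) -/s.
have /(reflection_quot_len adj')-> : above_reflection (s * z)%g c d 0.
  move: sz tz; rewrite /above_reflection !reflection_colM !reflection_expoM.
  rewrite !(td, tpermR) !(neq, eqxx) subr0 subrr add0r oppr0.
  case: ltnP => [lt_cb /eqP->|le_bc c_neq0]; case: ltnP => [lt_dc|le_cd].
  - by rewrite (ltn_trans lt_dc lt_cb) addrN.
  - by rewrite addrN eqxx => ->; case: ifP.
  - by move=> c_eq0; rewrite c_eq0 in c_neq0.
  - by rewrite ltnNge (leq_trans le_bc le_cd).
have /(reflection_quot_len adj)-> : above_reflection (t * (s * z))%g b c p.
  move: tz; rewrite /above_reflection !reflection_colM !reflection_expoM.
  rewrite !(tb, td, tpermL) !(neq, eqxx) !mul0rn !subrr !add0r oppr0.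
  by rewrite -[X in _ + _ == X]addr0 (inj_eq (addrI _)).
by rewrite !invgM !reflectionV -!mulgA addn3.
Qed.

End LambdaInterval.

Lemma is_join_inC (T : Type) (S : set T) (le : T -> T -> Prop) (a b j : T) :
  is_join_in S le a b j -> is_join_in S le b a j.
Proof. by case=> Sj aj bj j_min; split=> // c Sc bc ac; apply: j_min. Qed.

(** Two distinct generators act on the same pair of adjacent rows, on
overlapping pairs, or on disjoint pairs. *)
Lemma atom_join n k (s t : monomial n) : k != 0 -> atom s -> atom t -> s <> t ->
    lprefix (@mono_len n) s (mono_lambda n k) ->
    lprefix (@mono_len n) t (mono_lambda n k) ->
  exists m, is_join_in (fun z => lprefix (@mono_len n) z (mono_lambda n k))
    (lprefix (@mono_len n)) s t m.
Proof.
move=> k_neq0.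
wlog : s t / exists b c p b' c' q, [/\ s = reflection b c p,
    t = reflection b' c' q, adjacent b c p, adjacent b' c' q & (b <= b')%N].
  move=> ordered atom_s atom_t neq_st sD tD.
  have [b [c [p [adj sE]]]] := atom_s; have [b' [c' [q [adj' tE]]]] := atom_t.
  have [le_bb'|lt_b'b] := leqP b b'.
    by apply: ordered => //; exists b, c, p, b', c', q.
  have [||m join_m] := ordered t s _ atom_t atom_s _ tD sD.
  - by exists b', c', q, b, c, p; split=> //; apply: ltnW.
  - by move=> /esym.
  by exists m; apply: is_join_inC.
move=> [b [c [p [b' [c' [q [-> -> adj adj' le_bb']]]]]]] _ _ neq_st sD tD.
have [cb _] := adj; have [cb' q0] := adj'.
move: le_bb'; rewrite leq_eqVlt => /orP[/eqP/val_inj bb'|lt_bb'].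
  subst b'; have cc' : c' = c by apply: val_inj; rewrite /= cb cb'.
  subst c'; apply: join_same_pair => // pq.
  by apply: neq_st; rewrite pq.
move: lt_bb'; rewrite -cb leq_eqVlt => /orP[/eqP/val_inj cE|lt_cb']; last first.
  exact: join_far.
subst b'; move: adj' tD; rewrite q0 ?cb // => adj' tD.
exact: join_braid.
Qed.

Theorem mono_lambda_lattice n k : k != 0 ->
  is_lattice_on (fun z => lprefix (@mono_len n) z (mono_lambda n k))
    (lprefix (@mono_len n)) /\
  is_lattice_on (fun z => lprefix (@mono_len n) z (mono_lambda n k))
    (rprefix (@mono_len n)).
Proof.
move=> k_neq0.
have len_atom (s : monomial n) : atom s -> mono_len s = 1%N.
  by move=> [b [c [p [adj ->]]]]; apply: reflection_len.
have len0 (v : monomial n) : mono_len v = 0%N -> v = 1%g.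
  move=> len_v; apply/eqP/negPn/negP => /atom_descent[s /len_atom len_s].
  by rewrite mono_lprefixE len_s len_v.
have atom_neq1 (s : monomial n) : atom s -> s <> 1%g.
  by move=> /len_atom + s1; rewrite s1 mono_len1.
have bal (v : monomial n) := lambda_balanced v k_neq0.
have joins s t := @atom_join n k s t k_neq0.
split.
- exact: (balanced_interval_lattice (@mono_len1 n) len0 (@mono_len_mul n) bal
    (@atom_descent n) atom_neq1 joins).
- exact: (balanced_interval_lattice_r (@mono_len1 n) len0 (@mono_len_mul n) bal
    (@atom_descent n) atom_neq1 joins).
Qed.

(** * From labelled permutations to matrices *)

Section MonomialMatrices.
Variables (F : fieldType) (x : F) (n : nat).
Hypothesis x_neq0 : x != 0.
Hypothesis x_free : forall m : int, x ^ m = 1 -> m = 0.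
Implicit Types (u v w s : monomial n) (A : 'M[F]_n).

Definition mono_mx v : 'M[F]_n :=
  \matrix_(i, j) (x ^ expo v i *+ (j == mcol v i)).

Lemma mono_mx_row v i j : j != mcol v i -> mono_mx v i j = 0.
Proof. by rewrite mxE => /negbTE->. Qed.

Lemma mono_mx_col v i : mono_mx v i (mcol v i) = x ^ expo v i.
Proof. by rewrite mxE eqxx. Qed.

Lemma mono_mx_neq0 v i j : (mono_mx v i j != 0) = (j == mcol v i).
Proof.
have [->|neq] := eqVneq j (mcol v i); first by rewrite mono_mx_col expfz_neq0.
by rewrite mono_mx_row ?eqxx.
Qed.

Lemma mono_mx1 : mono_mx 1%g = 1%:M.
Proof.
by apply/matrixP=> i j; rewrite !mxE expo1 expr0z perm1 eq_sym.
Qed.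

Lemma mono_mxM v w : mono_mx (v * w)%g = mono_mx v *m mono_mx w.
Proof.
apply/matrixP=> i j; rewrite [RHS]mxE (bigD1 (mcol v i)) //= big1 ?addr0.
  by rewrite mono_mx_col !mxE expoM mcolM mulrnAr expfzDr.
by move=> l neq; rewrite mono_mx_row ?mul0r.
Qed.

Lemma mono_mxV v : mono_mx v^-1%g = invmx (mono_mx v).
Proof.
have vV : mono_mx v *m mono_mx v^-1%g = 1%:M by rewrite -mono_mxM mulgV mono_mx1.
have [v_unit _] := mulmx1_unit vV.
by rewrite -[LHS](mulKmx v_unit) vV mulmx1.
Qed.

Lemma mono_mx_inj : injective mono_mx.
Proof.
move=> v w /matrixP eq_vw.
have eq_col i : mcol v i = mcol w i.
  by apply/eqP; rewrite -mono_mx_neq0 -eq_vw mono_mx_neq0.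
apply: monomialP => [|i]; first exact/permP.
have := eq_vw i (mcol v i); rewrite mono_mx_col eq_col mono_mx_col => eq_x.
apply/eqP; rewrite -subr_eq0; apply/eqP/x_free.
by rewrite expfzDr // eq_x -expfzDr // subrr expr0z.
Qed.

Lemma mono_mx_G v : G_oo_oo x (mono_mx v).
Proof.
split; first split.
- move=> i; exists (mcol v i); split; first by rewrite mono_mx_neq0.
  by move=> j; rewrite mono_mx_neq0 => /eqP.
- move=> j; exists ((mcol v)^-1%g j); split; first by rewrite mono_mx_neq0 permKV.
  by move=> i; rewrite mono_mx_neq0 => /eqP->; rewrite permK.
- move=> i j; rewrite mono_mx_neq0 => /eqP->.
  by exists (expo v i); rewrite mono_mx_col.
have prodE i : \prod_(j | mono_mx v i j != 0) mono_mx v i j = x ^ expo v i.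
  by rewrite (big_pred1 (mcol v i)) ?mono_mx_col // => j; rewrite mono_mx_neq0.
rewrite (eq_bigr _ (fun i _ => prodE i)) -[RHS](expr0z x) -(expo_sum v).
apply/esym/(big_morph (fun m => x ^ m)); last by rewrite expr0z.
by move=> ? ?; rewrite expfzDr.
Qed.

Lemma G_mono_mx A : G_oo_oo x A -> exists v, mono_mx v = A.
Proof.
move=> [[rowA colA] expA prodA].
have /choice[f fP] : forall i, exists j,
    A i j != 0 /\ forall j', A i j' != 0 -> j = j'.
  by move=> i; have [j [? ?]] := rowA i; exists j.
have f_inj : injective f.
  move=> i i' eq_f; have [l [_ l_uniq]] := colA (f i).
  by rewrite -(l_uniq i) ?(fP i).1 // -(l_uniq i') // eq_f (fP i').1.
have /choice[a aP] : forall i, exists m : int, A i (f i) = x ^ m.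
  by move=> i; apply: expA; rewrite (fP i).1.
have sum_a : \sum_i [ffun i => a i] i == 0.
  apply/eqP/x_free; rewrite -[RHS]prodA.
  rewrite (big_morph (fun m => x ^ m) (id1 := 1) (op1 := *%R)); last first.
  - by rewrite expr0z.
  - by move=> ? ?; rewrite expfzDr.
  apply: eq_bigr => i _; rewrite ffunE (big_pred1 (f i)) ?aP // => j.
  by apply/idP/eqP => [/(fP i).2 //|->]; rewrite (fP i).1.
exists (@Monomial n (perm f_inj, _) sum_a); apply/matrixP=> i j.
rewrite mxE /mcol /expo /= ffunE permE.
have [->|neq] := eqVneq j (f i); first by rewrite aP.
have [->//|/(fP i).2 fij] := eqVneq (A i j) 0.
by rewrite fij eqxx in neq.
Qed.

Lemma expmxz_lambda k : expmxz (lambda x n) k = mono_mx (mono_lambda n k).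
Proof.
have lambdaE : lambda x n = mono_mx (mono_lambda n 1).
  apply/matrixP=> i j; rewrite !mxE expo_lambda perm1 [j == i]eq_sym.
  have [->|] := eqVneq i j; last by rewrite !mulr0n.
  rewrite !mulr1n; case: eqP => _; last by rewrite mulr0n subr0 expr1z.
  by congr (x ^ _); have := ltn_ord j; lia.
have lambdaX m : lambda x n ^+ m = mono_mx (mono_lambda n m).
  elim: m => [|m IHm]; first by rewrite expr0 mono_lambda0 mono_mx1.
  by rewrite exprS IHm lambdaE -[LHS]/(_ *m _) -mono_mxM -mono_lambdaD.
by case: k => m; rewrite /expmxz lambdaX // NegzE mono_lambdaN mono_mxV.
Qed.

Hypothesis n_gt1 : (1 < n)%N.

Lemma Xgen_mono_mx A : Xgen x A <-> exists2 s, atom s & mono_mx s = A.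
Proof.
pose o0 := Ordinal (ltnW n_gt1); pose o1 := Ordinal n_gt1.
have tgenE p : tgen x n p = mono_mx (reflection o0 o1 p).
  apply/matrixP=> i j; rewrite !mxE expo_reflection.
  rewrite -!val_eqE /= tperm_val /=.
  case: (nat_of_ord i) => [|[|m]] /=; rewrite ?mulr0n ?mulr1n ?sub0r ?subr0.
  - by case: (j == 1%N :> nat).
  - by case: (j == 0%N :> nat).
  - by rewrite eq_sym.
have tpermE (b c : 'I_n) : tperm_mx b c = mono_mx (reflection b c 0).
  apply/matrixP=> i j; rewrite !mxE expo_reflection !mul0rn subrr expr0z.
  by rewrite eq_sym.
split=> [[[p ->]|[b [c [b_gt0 cb ->]]]] | [_ [b [c [p [[cb p0] ->]]]] <-]].
- by exists (reflection o0 o1 p) => //; exists o0, o1, p.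
- by exists (reflection b c 0) => //; exists b, c, 0.
have [b0|b_gt0] := posnP b; last by right; exists b, c; rewrite p0.
left; exists p; rewrite tgenE.
by congr (mono_mx (reflection _ _ _)); apply: val_inj; rewrite /= ?cb b0.
Qed.

Lemma has_word_mono_len v : has_word x (mono_mx v) (mono_len v).
Proof.
have [N] := ubnP (mono_len v); elim: N v => // N IHN v; rewrite ltnS => leN.
have [->|v_neq1] := eqVneq v 1%g.
  by exists [::]; rewrite mono_len1 big_nil mono_mx1; split.
have [s atom_s sv] := atom_descent v_neq1.
have [b [c [p [adj sE]]]] := atom_s.
have len_s : mono_len s = 1%N by rewrite sE reflection_len.
move: sv; rewrite mono_lprefixE len_s add1n => len_v.
have [|r [size_r r_gen r_prod]] := IHN (s^-1 * v)%g.
  by rewrite -ltnS len_v ltnS.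
exists (mono_mx s :: r); split; first by rewrite /= size_r.
- move=> A; rewrite inE => /predU1P[->|/r_gen //].
  by apply/Xgen_mono_mx; exists s.
- by rewrite big_cons r_prod -[LHS]/(_ *m _) -mono_mxM mulVKg.
Qed.

(** With [has_word_mono_len], this identifies word length with [mono_len]: each
letter has length 1 and length is subadditive. *)
Lemma word_mono_len (r : seq 'M[F]_n) : (forall A, A \in r -> Xgen x A) ->
  exists2 u, mono_mx u = \prod_(A <- r) A & (mono_len u <= size r)%N.
Proof.
elim: r => [_|A r IHr gen_r].
  by exists 1%g; rewrite ?big_nil ?mono_mx1 ?mono_len1.
have [|u uE len_u] := IHr; first by move=> B Br; apply: gen_r; rewrite inE Br orbT.
have /Xgen_mono_mx[s [b [c [p [adj sE]]]] sA] := gen_r A (mem_head A r).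
exists (s * u)%g; first by rewrite mono_mxM big_cons sA uE.
by rewrite (leq_trans (mono_len_mul _ _)) // sE reflection_len.
Qed.

Lemma ell_mono_mx v : ell x (mono_mx v) = mono_len v.
Proof.
rewrite /ell; case: pselect => [ex|[]]; last first.
  by exists (mono_len v); apply/asboolP/has_word_mono_len.
case: ex_minnP => l /asboolP[r [size_r r_gen r_prod]] l_min.
apply/eqP; rewrite eqn_leq l_min /=; last exact/asboolP/has_word_mono_len.
have [u uE] := word_mono_len r_gen.
by rewrite -size_r; move: uE; rewrite r_prod => /mono_mx_inj->.
Qed.

Lemma prec_mono_mx v w :
  prec x (mono_mx v) (mono_mx w) <-> lprefix (@mono_len n) v w.
Proof. by rewrite /prec -mono_mxV -mono_mxM !ell_mono_mx. Qed.

Lemma precr_mono_mx v w :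
  precr x (mono_mx v) (mono_mx w) <-> rprefix (@mono_len n) v w.
Proof. by rewrite /precr -mono_mxV -mono_mxM !ell_mono_mx. Qed.

Lemma interval1_mono_mx w A : interval1 x (mono_mx w) A <->
  exists2 v, lprefix (@mono_len n) v w & mono_mx v = A.
Proof.
split=> [[/G_mono_mx[v <-] /prec_mono_mx vw] | [v /prec_mono_mx vw <-]].
  by exists v.
by split; [apply: mono_mx_G|].
Qed.

End MonomialMatrices.

(** * The theorem *)

Lemma transcendental_neq0 (K F : fieldType) (iota : {rmorphism K -> F}) (x : F) :
  ~ algebraicOver iota x -> x != 0.
Proof.
move=> x_transc; apply/eqP=> x0; apply: x_transc; exists 'X.
  by rewrite polyX_eq0.
by rewrite map_polyX x0 rootX.
Qed.

Lemma transcendental_expz (K F : fieldType) (iota : {rmorphism K -> F}) (x : F) :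
  ~ algebraicOver iota x -> forall m : int, x ^ m = 1 -> m = 0.
Proof.
move=> x_transc.
have pow m : x ^+ m = 1 -> m = 0%N.
  case: m => // m xm; case: x_transc; exists ('X^(m.+1) - 1).
    by rewrite -size_poly_eq0 size_XnsubC.
  by rewrite rmorphB /= map_polyXn rmorph1 /root !hornerE xm subrr.
case=> m xm; first by rewrite (pow m).
have /(congr1 GRing.inv) : (x ^+ m.+1)^-1 = 1 := xm.
by rewrite invrK invr1 => /pow.
Qed.

Theorem theorem4p22 (K F : fieldType) (iota : {rmorphism K -> F}) (x : F)
    (hx : ~ algebraicOver iota x) (n : nat) (hn : (2 <= n)%N)
    (k : int) (hk : k != 0) :
  is_lattice_on (interval1 x (expmxz (lambda x n) k)) (@prec F x n) /\
  is_lattice_on (interval1 x (expmxz (lambda x n) k)) (@precr F x n).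
Proof.
have x_neq0 := transcendental_neq0 hx; have x_free := transcendental_expz hx.
have [latl latr] := mono_lambda_lattice n hk.
have intervalP := interval1_mono_mx x_neq0 x_free hn (mono_lambda n k).
rewrite (expmxz_lambda n x_neq0); split.
- apply: (is_lattice_on_image intervalP _ latl) => v w _ _.
  exact: prec_mono_mx.
- apply: (is_lattice_on_image intervalP _ latr) => v w _ _.
  exact: precr_mono_mx.
Qed.
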